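(* Let $G$ be a finite simple graph with girth at least $9$. If $G$ has a good set, then $\chi_b(G) = m(G)$.
   Context: A b-vertex of a (proper) vertex coloring is a vertex that has a neighbor of every color other than its own. A b-coloring of $G$ is a proper vertex coloring in which every color class contains a b-vertex. The b-chromatic number $\chi_b(G)$ is the largest integer $k$ such that $G$ has a b-coloring with exactly $k$ colors. $m(G)$ denotes the largest integer $k$ such that $G$ has at least $k$ vertices of degree at least $k-1$. A vertex $u$ is dense if $d(u) \ge m(G)-1$; $M(G)$ is the set of dense vertices. For $W \subseteq M(G)$ and $u \in V(G)\setminus W$, we say $W$ encircles $u$ if every vertex $v \in W$ is either adjacent to $u$ or has a common neighbor $w \in W$ with $u$ such that $d(w) = m(G)-1$. A subset $W \subseteq M(G)$ with $|W| = m(G)$ is a good set if (a) $W$ does not encircle any vertex of $V(G)\setminus W$, and (b) every vertex $x \in V(G)\setminus W$ with $d(x) \ge m(G)$ is adjacent to some vertex of $W$. The girth of $G$ is the length of a shortest cycle of $G$. *)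

(* Defs.v *)
From mathcomp Require Import all_boot.

Set Implicit Arguments.
Unset Strict Implicit.
Unset Printing Implicit Defensive.

(* A finite simple graph on the vertex set T is given by its adjacency relation
   [e : rel T], assumed symmetric and irreflexive where it is used. *)

Section Graph.
Variables (T : finType) (e : rel T).

Definition nbh (v : T) : {set T} := [set u | e v u].

Definition deg (v : T) : nat := #|nbh v|.

(* The bound 2 < l rules out the closed walks x, y, x along an edge, which
   [ucycleb] accepts as cycles of length 2. *)
Definition has_cycle (l : nat) : bool :=
  (2 < l) && [exists c : l.-tuple T, ucycleb e c].

(* The vertices of a cycle are distinct, so only lengths up to #|T| matter;
   [None] is the infinite girth of a forest. *)
Definition girth : option nat := ohead [seq l <- iota 0 #|T|.+1 | has_cycle l].

Definition girth_geq (g : nat) : bool :=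
  if girth is Some l then g <= l else true.

Definition proper_coloring (k : nat) (c : {ffun T -> 'I_k}) : bool :=
  [forall u, forall v, e u v ==> (c u != c v)].

Definition b_vertex (k : nat) (c : {ffun T -> 'I_k}) (v : T) : bool :=
  [forall j : 'I_k, (j != c v) ==> [exists u in nbh v, c u == j]].

(* Every element of 'I_k is the color of some b-vertex, so all k colors are
   used: this is a b-coloring with exactly k colors. *)
Definition b_coloring (k : nat) (c : {ffun T -> 'I_k}) : bool :=
  proper_coloring c &&
  [forall i : 'I_k, [exists v, (c v == i) && b_vertex c v]].

(* A b-coloring has at most #|T| colors. *)
Definition b_chromatic : nat :=
  \max_(k < #|T|.+1 | [exists c : {ffun T -> 'I_k}, b_coloring c]) k.

(* For k = 0 the truncated k.-1 is harmless: the condition holds either way. *)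
Definition m_degree : nat :=
  \max_(k < #|T|.+1 | k <= #|[set v | k.-1 <= deg v]|) k.

Definition dense_set : {set T} := [set u | m_degree.-1 <= deg u].

(* Only meaningful for W \subset dense_set and u \notin W. *)
Definition encircles (W : {set T}) (u : T) : bool :=
  [forall v in W,
     e v u || [exists w in W, [&& e v w, e u w & deg w == m_degree.-1]]].

Definition good_set (W : {set T}) : bool :=
  [&& W \subset dense_set,
      #|W| == m_degree,
      [forall u in ~: W, ~~ encircles W u]
    & [forall x in ~: W,
         (m_degree <= deg x) ==> [exists w in W, e x w]]].

End Graph.

(* Main.v *)
Require Import Defs.
From mathcomp Require Import all_boot.
From mathcomp Require Import zify.

(* The colors are the vertices of the good set W, each w in W receiving itself.
   Vertices outside W with at least two neighbors in W (links) are colored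
   first, avoiding their neighbors in W and the neighbors of these in W, so that
   no link is wasted for any w; non-encirclement is needed only for a link from
   which every vertex of W is that close, and then it is the only link.  Next
   the remaining neighbors of each w in turn receive the colors w still misses.
   Both steps are greedy: by the girth, each colored vertex that obstructs a
   choice leads to a vertex of W of its own, whose color is one of the allowed
   or missing ones, so that obstructions never outnumber choices.  In case of
   equality the obstructions lead to all remaining vertices of W, so that W lies
   within a bounded distance; then coloring one suitable obstructing vertex, at the
   start, with a color that obstructs nothing, or treating the critical vertex
   first, restores the strict inequality.  All uncolored vertices now have
   degree less than m(G), and greedy coloring finishes. *)

Set Implicit Arguments.
Unset Strict Implicit.
Unset Printing Implicit Defensive.

(** * Nonbacktracking walks *)

Section Walks.
Variables (T : finType) (e : rel T).
Hypotheses (e_sym : symmetric e) (e_irr : irreflexive e).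
Hypothesis e_girth : girth_geq e 9.

Lemma cycle_geq9 (s : seq T) : 2 < size s -> ucycle e s -> 9 <= size s.
Proof.
move=> s2 cs.
have sT : size s <= #|T|.
  by rewrite -(card_uniqP (ucycle_uniq cs)) max_card.
have hs : has_cycle e (size s).
  rewrite /has_cycle s2; apply/existsP; exists (in_tuple s).
  exact: cs.
move: e_girth; rewrite /girth_geq /girth.
have : size s \in [seq l <- iota 0 #|T|.+1 | has_cycle e l].
  by rewrite mem_filter hs mem_iota ltnS.
have : sorted leq [seq l <- iota 0 #|T|.+1 | has_cycle e l].
  by apply: sorted_filter; [exact: leq_trans | exact: iota_sorted].
case: [seq _ <- _ | _] => //= h t /(order_path_min leq_trans)/allP ht.
rewrite inE => /orP[/eqP-> //|/ht] hl h9; exact: leq_trans h9 hl.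
Qed.

Fixpoint nb_walk (s : seq T) : bool :=
  if s is x :: s1 then
    (if s1 is y :: s2 then e x y && (if s2 is z :: _ then x != z else true)
     else true) && nb_walk s1
  else true.

Lemma nb_walk_path x s : nb_walk (x :: s) -> path e x s.
Proof.
elim: s x => //= y s IH x /andP[/andP[-> _] h] /=; exact: IH.
Qed.

(** By induction only the head can repeat. The vertices before its second occurrence then form a
    cycle of length at most 8; the degenerate cases are a loop and a backtracking step. *)
Lemma nb_walk_uniq s : nb_walk s -> size s <= 9 -> uniq s.
Proof.
elim: s => // x s IH w sz.
have us : uniq s by apply: IH (ltnW sz); case/andP: w.
rewrite /= us andbT; apply/negP => xs.
case/splitPr: xs us w sz => p1 p2 us w sz.
have := nb_walk_path w; rewrite -cat_rcons cat_path last_rcons => /andP[px _].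
have up : uniq (rcons p1 x).
  by move: us; rewrite -cat_rcons cat_uniq => /andP[].
case: p1 us w sz px up => [|y [|z p1]] us w sz px up.
- by move: px; rewrite /= e_irr.
- by move: w; rewrite /= eqxx andbF.
- have c : ucycle e (x :: [:: y, z & p1]).
    by apply/andP; split; [exact: px | move: up; rewrite rcons_uniq].
  have := cycle_geq9 (isT : 2 < size (x :: [:: y, z & p1])) c.
  by move: sz; rewrite /= !size_cat /=; lia.
Qed.

Lemma nb_walk_catrev x p q :
  nb_walk (x :: p) -> nb_walk (x :: q) ->
  (if p is y :: _ then if q is z :: _ then y != z else true else true) ->
  nb_walk (catrev p (x :: q)).
Proof.
elim: p x q => // y p IH x q /andP[/andP[exy np] wp] wq hd.
rewrite [catrev _ _]/=; apply: IH => //.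
  have -> : nb_walk [:: y, x & q] =
    e y x && (if q is z :: _ then y != z else true) && nb_walk (x :: q) by [].
  by rewrite e_sym exy wq hd.
by case: p {wp} np => // z p; rewrite eq_sym.
Qed.

(** Common first steps are stripped. Once the walks diverge, or one is exhausted, reversing one and
    appending the other gives a nonbacktracking walk on at most 9 vertices whose ends coincide,
    against [nb_walk_uniq]. *)
Lemma nb_walk_eq x p q :
  nb_walk (x :: p) -> nb_walk (x :: q) -> last x p = last x q ->
  size p + size q <= 8 -> p = q.
Proof.
elim: p x q => [|y p IH] x [|z q] // wp wq.
- move=> /= xl sz; have := nb_walk_uniq wq.
  by rewrite /= {1}xl mem_last => /(_ ltac:(lia)).
- move=> /= xl sz; have := nb_walk_uniq wp.
  by rewrite /= -{1}xl mem_last => /(_ ltac:(lia)).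
have [E|yz] := eqVneq y z.
  subst z.
  move=> l sz; congr (_ :: _); apply: (IH y) => //.
  - by case/andP: wp.
  - by case/andP: wq.
  - by move: sz => /=; lia.
move=> l sz; have w := nb_walk_catrev wp wq yz.
have := nb_walk_uniq w; rewrite catrevE size_cat size_rev.
move=> /(_ ltac:(move: sz => /=; lia)).
rewrite lastI rev_rcons cat_cons cons_uniq mem_cat.
have -> : last y p = last z q by [].
by rewrite inE mem_last !orbT.
Qed.

(* A nonbacktracking walk of length at most k from u to a, with last step from z
   to a; the walk is stored from a back to u. *)
Definition reach (k : nat) (u z a : T) : Prop :=
  exists s, [/\ nb_walk [:: a, z & s], last z s = u & size s < k].

Lemma reach1 u a : e u a -> reach 1 u u a.
Proof. by move=> ua; exists [::]; split; rewrite //= e_sym ua. Qed.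

Lemma reachS k u z a b : reach k u z a -> e a b -> b != z -> reach k.+1 u a b.
Proof.
move=> [s [w l sz]] ab bz; exists (z :: s); split=> //.
have -> : nb_walk [:: b, a, z & s] =
  e b a && (b != z) && nb_walk [:: a, z & s] by [].
by rewrite e_sym ab bz w.
Qed.

Lemma reachW j k u z a : reach j u z a -> j <= k -> reach k u z a.
Proof. by move=> [s [w l sz]] jk; exists s; split=> //; apply: leq_trans jk. Qed.

(* All uses of the girth assumption go through this lemma. *)
Lemma reach_uniq j k u z z' a :
  reach j u z a -> reach k u z' a -> j + k <= 8 -> z = z'.
Proof.
move=> [s [w l sz]] [s' [w' l' sz']] jk.
suff: z :: s = z' :: s' by case.
by apply: (nb_walk_eq w w'); rewrite /= ?l ?l' //; lia.
Qed.

End Walks.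

(** * Greedy assignments *)

(** Induction on [#|B|]: an element with a forbidden pair is served first, by an allowed color. Its
    whole row of pairs disappears, so the forbidden pairs decrease at least as fast as the colors.
    Elements left over at the end take the default [d]. *)
Lemma assign_avoiding (T C : finType) (X : {set T}) (B : {set C})
    (forb : T -> C -> bool) (d : T -> C) :
  #|B| <= #|X| ->
  B = set0 \/ #|[set p in setX X B | forb p.1 p.2]| < #|B| ->
  {in X, forall x, ~~ forb x (d x)} ->
  exists f : T -> C,
    {in X, forall x, ~~ forb x (f x) /\ (f x \in B \/ f x = d x)} /\
    {in B, forall b, exists2 x, x \in X & f x = b}.
Proof.
move=> BX hF hd; move n: #|B| => k; elim: k X B n BX hF hd => [|k IH] X B n BX hF hd.
  exists d; split=> [x xX|b]; first by split; [exact: hd | right].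
  by rewrite (cards0_eq n) inE.
case: hF => [B0|hF]; first by rewrite B0 cards0 in n.
set F := [set p in _ | _] in hF.
suff [x [c [xX cB xc hF']]] : exists x c, [/\ x \in X, c \in B, ~~ forb x c &
   F = set0 \/ exists2 b, b \in B & forb x b].
  have nB : #|B :\ c| = k by move: (cardsD1 c B); rewrite cB n add1n => -[].
  have nX : #|X| = #|X :\ x|.+1 by rewrite (cardsD1 x X) xX add1n.
  have [||x' /setD1P[_ /hd] //|f [f1 f2]] := IH (X :\ x) (B :\ c) nB; first by lia.
    set F' := [set p in _ | _]; rewrite nB.
    have sF : F' \subset F.
      apply/subsetP => p; rewrite !inE.
      by case/andP=> /andP[/andP[_ ->] /andP[_ ->]] ->.
    case: (posnP k) => [k0|k0]; first by left; apply: cards0_eq; rewrite nB.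
    right; case: hF' => [F0|[b bB xb]].
      by move: sF; rewrite F0 subset0 => /eqP->; rewrite cards0.
    have : F' \subset F :\ (x, b).
      apply/subsetP => p pF; rewrite in_setD1 (subsetP sF) // andbT.
      by apply/eqP => pE; move: pF; rewrite pE !inE eqxx.
    have Fxb : (x, b) \in F by rewrite !inE xX bB.
    move/subset_leq_card; have := cardsD1 (x, b) F; rewrite Fxb; lia.
  exists (fun t => if t == x then c else f t); split=> [t tX|b bB].
    case: eqP => [->|/eqP tx]; first by split=> //; left.
    have [|? [/setD1P[_ ?]|?]] := f1 t; first by rewrite !inE tx.
      by split=> //; left.
    by split=> //; right.
  have [->|bc] := eqVneq b c; first by exists x; rewrite ?eqxx.
  have [|t /setD1P[tx tX] <-] := f2 b; first by rewrite !inE bc.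
  by exists t; rewrite // (negbTE tx).
have [F0|[[x b]]] := set_0Vmem F.
  have [x xX] : exists x, x \in X by apply/card_gt0P; lia.
  have [c cB] : exists c, c \in B by apply/card_gt0P; lia.
  exists x, c; split=> //; last by left.
  by apply/negP => xc; move/setP/(_ (x, c)): F0; rewrite !inE xX cB xc.
rewrite !inE => /andP[/andP[xX bB] xb].
(* A row made of forbidden pairs only would already contain [#|B|] of them. *)
have [c cB xc] : exists2 c, c \in B & ~~ forb x c.
  apply/exists_inP; rewrite -negb_forall_in; apply/negP => /forall_inP h.
  move: hF; rewrite ltnNge => /negP; apply.
  rewrite -(card_imset _ (fun c c' => @congr1 _ _ snd (x, c) (x, c'))).
  apply: subset_leq_card; apply/subsetP => _ /imsetP[c cB ->].
  by rewrite !inE xX cB h.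
by exists x, c; split=> //; right; exists b.
Qed.

Section Greedy.
Variables (T C : finType) (r : rel T) (F : T -> {set C}).
Hypothesis (r_sym : symmetric r) (r_irr : irreflexive r).

Definition list_coloring (S : {set T}) (c : T -> C) : Prop :=
  {in S, forall x, c x \in F x} /\
  {in S &, forall x y, r x y -> c x <> c y}.

Lemma list_coloring1 S c x :
  list_coloring S c -> x \notin S ->
  #|[set y in S | r x y & c y \in F x]| < #|F x| ->
  exists c', list_coloring (x |: S) c' /\ {in S, c' =1 c}.
Proof.
move=> [c1 c2] xS lt.
have [b bF bn] : exists2 b, b \in F x & b \notin [set c y | y in S & r x y].
  apply/exists_inP; rewrite -negb_forall_in; apply/negP => /forall_inP h.
  move: lt; rewrite ltnNge => /negP; apply.
  apply: leq_trans (leq_imset_card c _); apply: subset_leq_card.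
  apply/subsetP => b bF; case/imsetP: (h b bF) => y; rewrite inE => /andP[yS xy] E.
  by apply/imsetP; exists y; rewrite // inE yS xy -E.
have bn' y : y \in S -> r x y -> c y <> b.
  by move=> yS xy E; case/imsetP: bn; exists y; rewrite // inE yS.
have nx y : y \in S -> (y == x) = false.
  by move=> yS; apply/eqP => E; rewrite -E yS in xS.
exists (fun t => if t == x then b else c t); split; last by move=> y /nx ->.
split=> [y /setU1P[->|yS]|y z /setU1P[->|yS] /setU1P[->|zS]].
- by rewrite eqxx.
- by rewrite (nx y yS); exact: c1.
- by rewrite r_irr.
- by rewrite eqxx (nx z zS) => /(bn' z zS) h E; case: h.
- by rewrite eqxx (nx y yS) r_sym; exact: bn'.
- by rewrite (nx y yS) (nx z zS); exact: c2.
Qed.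

(** A neighbor in [S] counts against [x] only if its known color lies in [F x]; a neighbor still to
    be colored always counts, so the order of coloring does not matter. *)
Lemma list_coloring_greedy (S A : {set T}) (c : T -> C) :
  list_coloring S c ->
  {in A, forall x, #|[set y in (S :|: A) :\ x | r x y &
     (y \in S) ==> (c y \in F x)]| < #|F x|} ->
  exists c', list_coloring (S :|: A) c' /\ {in S, c' =1 c}.
Proof.
move=> cS; move n: #|A :\: S| => k; elim: k A n => [|k IH] A n hA.
  exists c; suff -> : S :|: A = S by [].
  by apply/setUidPl; rewrite -setD_eq0 (cards0_eq n).
have [x] : exists x, x \in A :\: S by apply/card_gt0P; rewrite n.
rewrite inE => /andP[xS xA].
have [||c1 [c1c c1S]] := IH (A :\ x).
- have : (A :\ x) :\: S = (A :\: S) :\ x.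
    by apply/setP => y; rewrite !inE; case: (y \in S); rewrite ?andbF ?andbT.
  by move=> ->; have := cardsD1 x (A :\: S); rewrite n inE xA xS; lia.
- move=> y /setD1P[yx yA]; apply: leq_ltn_trans (hA y yA).
  apply: subset_leq_card; apply/subsetP => z; rewrite !inE.
  by case/andP=> /andP[-> /orP[->|/andP[_ ->]]] ->; rewrite ?orbT.
have [||c2 [c2c c2S]] := list_coloring1 (x := x) c1c.
- by rewrite !inE eqxx (negbTE xS).
- apply: leq_ltn_trans (hA x xA); apply: subset_leq_card; apply/subsetP => y.
  rewrite !inE => /and3P[/orP[yS|/andP[yx yA]] -> h].
    have yx : y != x by apply/eqP => E; rewrite -E yS in xS.
    by rewrite yx yS -c1S.
  rewrite yx yA orbT /=; apply/implyP => yS; by rewrite -c1S.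
exists c2; split.
  suff <- : x |: (S :|: A :\ x) = S :|: A by [].
  by apply/setP => y; rewrite !inE; case: eqP => [->|]; rewrite ?xA ?orbT.
by move=> y yS; rewrite c2S ?c1S // inE yS.
Qed.

End Greedy.

Lemma inj_card_surj (S R : finType) (Z : {set S}) (X : {set R}) (g : S -> R) :
  {in Z, forall z, g z \in X} -> {in Z &, injective g} -> #|X| <= #|Z| ->
  {in X, forall x, exists2 z, z \in Z & x = g z}.
Proof.
move=> gX gi le x xX.
have : g @: Z == X.
  rewrite eqEcard card_in_imset // le andbT.
  by apply/subsetP => _ /imsetP[z /gX h ->].
by move/eqP=> E; rewrite -E in xX; case/imsetP: xX => z; exists z.
Qed.

(** * Coloring around a good set *)

Section GoodSet.
Variables (T : finType) (e : rel T).
Hypotheses (e_sym : symmetric e) (e_irr : irreflexive e).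
Hypothesis e_girth : girth_geq e 9.
Variable W : {set T}.
Hypothesis W_dense : {in W, forall w, #|W|.-1 <= deg e w}.
Hypothesis W_encircles : forall u, u \notin W -> exists2 v, v \in W &
  ~~ e u v /\ forall w, w \in W -> e u w -> deg e w = #|W|.-1 -> ~~ e w v.

Local Notation reach := (reach e).
Let reach1 := @reach1 T e e_sym.
Let reachS := @reachS T e e_sym.
Let reach_uniq := @reach_uniq T e e_sym e_irr e_girth.
Local Notation N := (nbh e).

(** * Links, their available colors and their conflicts *)

Definition ends (u : T) : {set T} := N u :&: W.
Definition links : {set T} := [set u | u \notin W & 1 < #|ends u|].
Definition missing (w : T) : {set T} := [set v in W | (v != w) && ~~ e w v].
(** These are exactly the colors missing at every end of [u]: with such a color, [u] serves all its
    ends at once. *)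
Definition avail (u : T) : {set T} :=
  [set v in W | ~~ e u v & [forall w in ends u, ~~ e w v]].
(** Pairs that need different colors: adjacent ones for properness, and ones with a common end so
    that both supply it with a new color. *)
Definition conf (u v : T) : bool :=
  (u != v) && (e u v || (ends u :&: ends v != set0)).
Definition conflicts (u : T) : {set T} := [set v in links | conf u v].

Lemma endsE u v : (v \in ends u) = e u v && (v \in W).
Proof. by rewrite !inE. Qed.

Lemma W_neq a u : a \in W -> u \notin W -> a != u.
Proof. by move=> aW; apply: contraNneq => <-. Qed.

Lemma conf_sym : symmetric conf.
Proof. by move=> u v; rewrite /conf eq_sym e_sym setIC. Qed.

Lemma conf_neq u v : conf u v -> u != v.
Proof. by case/andP. Qed.

Lemma conf_irr : irreflexive conf.
Proof. by move=> u; rewrite /conf eqxx. Qed.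

Lemma common_end u v a b : u != v ->
  a \in ends u -> a \in ends v -> b \in ends u -> b \in ends v -> a = b.
Proof.
rewrite !endsE eq_sym => vu /andP[ua _] /andP[va _] /andP[ub _] /andP[vb _].
rewrite e_sym in va; rewrite e_sym in vb.
exact: (reach_uniq (reachS (reach1 ua) va vu) (reachS (reach1 ub) vb vu)).
Qed.

Lemma link_other_end u a : u \in links -> exists2 b, b \in ends u & b != a.
Proof.
rewrite inE => /andP[_ lt].
have : 0 < #|ends u :\ a| by have := cardsD1 a (ends u); lia.
by case/card_gt0P => b /setD1P[ba bu]; exists b.
Qed.

Lemma links_end u v : u \in links -> v \in links -> u != v ->
  exists2 a, a \in ends v & a \notin ends u.
Proof.
move=> uL vL uv; have [a av _] := link_other_end u vL.
have [au|] := boolP (a \in ends u); last by exists a.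
have [b bv ba] := link_other_end a vL; exists b => //.
by apply: contra ba => bu; apply/eqP; exact: (common_end uv bu bv au av).
Qed.

(** The walk goes from [u] to [v], directly or through a common end, and on to [a]. *)
Lemma conf_reach u v a : u \notin W -> v \notin W -> conf u v ->
  a \in ends v -> a \notin ends u -> reach 3 u v a.
Proof.
move=> uW vW /andP[uv cuv]; rewrite !endsE => /andP[va aW].
rewrite aW andbT => ua; have au := W_neq aW uW.
case/orP: cuv => [euv|/set0Pn[t]].
  by apply: reachW (reachS (reach1 euv) va au) _.
rewrite inE !endsE => /andP[/andP[ut tW] /andP[vt _]].
rewrite e_sym in vt; rewrite eq_sym in uv.
apply: reachS (reachS (reach1 ut) vt uv) va _.
by apply: contraNneq ua => ->.
Qed.

(** An end of [u] adjacent to [a] would give a second short walk from [u] to [a], whose last step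
    does not start at [v]. *)
Lemma conf_avail u v a : u \notin W -> v \notin W -> conf u v ->
  a \in ends v -> a \notin ends u -> a \in avail u.
Proof.
move=> uW vW cuv av au; have r3 := conf_reach uW vW cuv av au.
move: av au; rewrite !endsE inE => /andP[va aW]; rewrite aW andbT => ua.
rewrite ua /=; apply/forall_inP => w; rewrite endsE => /andP[uw wW].
apply/negP => wa; have au := W_neq aW uW.
have vw := reach_uniq r3 (reachS (reach1 uw) wa au) isT.
by rewrite vw wW in vW.
Qed.

Lemma links_notW u : u \in links -> u \notin W.
Proof. by rewrite inE => /andP[]. Qed.

Lemma in_conflicts u v : (v \in conflicts u) = (v \in links) && conf u v.
Proof. by rewrite inE. Qed.

(** For a link [u], this maps its conflicts injectively to its available colors, so conflicts never
    outnumber choices. The default is not reached for distinct links. *)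
Definition own_end u v := odflt v [pick a in ends v :\: ends u].

Lemma own_endP u v : u \in links -> v \in links -> u != v ->
  own_end u v \in ends v :\: ends u.
Proof.
move=> uL vL uv; rewrite /own_end; case: pickP => //= h.
by have [a av au] := links_end uL vL uv; move: (h a); rewrite inE av au.
Qed.

Lemma own_end_avail u : u \in links -> {in conflicts u, forall v, own_end u v \in avail u}.
Proof.
move=> uL v; rewrite inE => /andP[vL cuv].
have /setDP[a1 a2] := own_endP uL vL (conf_neq cuv).
exact: (conf_avail (links_notW uL) (links_notW vL) cuv).
Qed.

Lemma own_end_inj u : u \in links -> {in conflicts u &, injective (own_end u)}.
Proof.
move=> uL v v'; rewrite !in_conflicts => /andP[vL cv] /andP[vL' cv'] E.
have /setDP[a1 a2] := own_endP uL vL (conf_neq cv).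
have /setDP[a1' a2'] := own_endP uL vL' (conf_neq cv').
have r := conf_reach (links_notW uL) (links_notW vL) cv a1 a2.
have r' := conf_reach (links_notW uL) (links_notW vL') cv' a1' a2'.
by rewrite E in r; exact: (reach_uniq r r').
Qed.

Lemma conflicts_leq u : u \in links -> #|conflicts u| <= #|avail u|.
Proof.
move=> uL; rewrite -(card_in_imset (own_end_inj uL)).
apply: subset_leq_card; apply/subsetP => _ /imsetP[v vc ->].
exact: own_end_avail.
Qed.

Lemma conflicts_tight u : u \in links -> #|avail u| <= #|conflicts u| ->
  {in avail u, forall a, exists2 v, v \in conflicts u & a \in ends v}.
Proof.
move=> uL le a aA.
have [v vc ->] := inj_card_surj (own_end_avail uL) (own_end_inj uL) le aA.
exists v => //; move: vc; rewrite inE => /andP[vL cuv].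
by have /setDP[] := own_endP uL vL (conf_neq cuv).
Qed.

(* The ends of a non-conflicting link v would be joined to u by walks of length
   at most 3 avoiding v, giving a cycle of length at most 8. *)
Lemma tight_conf u : u \in links -> #|avail u| <= #|conflicts u| ->
  {in links, forall v, v != u -> conf u v}.
Proof.
move=> uL le v vL vu; apply/negPn/negP => ncv.
have uW := links_notW uL; have vW := links_notW vL.
(* If [a] is available at [u], tightness makes it an end of a conflict of [u]; otherwise it is
   adjacent to an end of [u]. *)
have near a : a \in ends v -> exists2 z, reach 3 u z a & z != v.
  rewrite endsE => /andP[va aW]; have au := W_neq aW uW.
  have nua : ~~ e u a.
    apply: contra ncv => ua; rewrite /conf eq_sym vu /=; apply/orP; right.
    by apply/set0Pn; exists a; rewrite inE !endsE ua va aW.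
  have [aA|] := boolP (a \in avail u).
    have [t tc ta] := conflicts_tight uL le aA.
    move: tc; rewrite inE => /andP[tL cut]; exists t.
      by apply: conf_reach cut ta _; rewrite // ?links_notW // endsE (negbTE nua).
    by apply: contraNneq ncv => <-.
  rewrite inE aW nua /= negb_forall_in => /exists_inP[w].
  rewrite endsE negbK => /andP[uw wW] wa; exists w; last exact: W_neq.
  by apply: reachW (reachS (reach1 uw) wa au) _.
have [a av _] := link_other_end u vL.
have [b bv ba] := link_other_end a vL.
have [z ra za] := near a av; have [z' rb zb] := near b bv.
move: av bv; rewrite !endsE => /andP[va aW] /andP[vb bW].
rewrite e_sym in va; rewrite eq_sym in za.
have r5 := reachS (reachS ra va za) vb ba.
by move/eqP: zb; apply; apply: (reach_uniq rb r5).
Qed.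

(** * Room for the missing colors, and the coloring of the links *)

Lemma missing_card w : w \in W -> #|N w :&: W| + #|missing w| = #|W|.-1.
Proof.
move=> wW; have := cardsD1 w W; rewrite wW.
have -> : W :\ w = (N w :&: W) :|: missing w.
  apply/setP => v; rewrite !inE; case: (boolP (v == w)) => [/eqP->|_] /=.
    by rewrite e_irr andbF.
  by case: (v \in W) (e w v) => [] [].
rewrite cardsU; suff -> : (N w :&: W) :&: missing w = set0 by rewrite cards0; lia.
by apply/setP => v; rewrite !inE; case: (e w v); rewrite ?andbF.
Qed.

Lemma missing_leq w : w \in W ->
  #|missing w| + (deg e w - #|W|.-1) <= #|N w :\: W|.
Proof.
move=> wW; have := missing_card wW; have := W_dense wW.
by have := cardsID W (N w); rewrite /deg; lia.
Qed.

Lemma missing_sym w v : w \in W -> v \in missing w -> w \in missing v.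
Proof. by move=> wW; rewrite !inE wW eq_sym e_sym => /and3P[_ -> ->]. Qed.

(** Each neighbor of [w] in [K] takes away one neighbor outside [W] and one missing color, so the
    inequality of [missing_leq] persists. *)
Lemma enough_rest (K : {set T}) (c : T -> T) w : w \in W -> [disjoint K & W] ->
  {in N w :&: K, forall u, c u \in missing w} ->
  {in N w :&: K &, injective c} ->
  #|missing w :\: c @: (N w :&: K)| <= #|N w :\: W :\: K|.
Proof.
move=> wW KW cm ci.
have /setIidPr E : c @: (N w :&: K) \subset missing w.
  by apply/subsetP => _ /imsetP[u /cm h ->].
rewrite cardsD E card_in_imset //; have := missing_leq wW.
rewrite (cardsD (N w :\: W)); suff -> : (N w :\: W) :&: K = N w :&: K by lia.
apply/setP => v; rewrite !inE; have [vK|] := boolP (v \in K); rewrite ?andbF //.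
by rewrite (disjointFr KW vK).
Qed.

Lemma color_links : exists c : T -> T,
  [/\ {in W, forall w, c w = w},
      {in links, forall u, c u \in W :\: ends u},
      {in links &, forall u v, e u v -> c u <> c v} &
      {in W, forall w, #|missing w :\: c @: (N w :&: links)| <=
                       #|N w :\: W :\: links|}].
Proof.
have LW : [disjoint links & W].
  by rewrite disjoint_sym disjoints_subset; apply/subsetP => w wW; rewrite !inE wW.
(* If u has no available color, it is the only link. *)
have [[u uL u0]|av0] : (exists2 u, u \in links & avail u = set0) \/
    {in links, forall u, 0 < #|avail u|}.
  have [/exists_inP[u uL /eqP]|] := boolP [exists u in links, avail u == set0].
    by left; exists u.
  rewrite negb_exists_in => /forall_inP h; right => u uL.
  by rewrite card_gt0 h.
- have EL v : v \in links -> v = u.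
    move=> vL; apply/eqP/negPn/negP => vu.
    have le : #|avail u| <= #|conflicts u| by rewrite u0 cards0.
    have cuv := tight_conf uL le vL vu.
    have := conflicts_leq uL; rewrite u0 cards0 leqn0 cards_eq0 => /eqP/setP/(_ v).
    by rewrite in_conflicts vL cuv inE.
  have uW := links_notW uL.
  (* The witness [v] of non-encirclement becomes the color of [u]. It is missing at every end of [u]
     of degree exactly [#|W|.-1], the ends without a spare neighbor. *)
  have [v vW [uv hv]] := W_encircles uW.
  pose c z := if z == u then v else z.
  exists c; split.
  + by move=> w wW; rewrite /c; case: eqP => // E; rewrite -E wW in uW.
  + by move=> z /EL->; rewrite /c eqxx !inE vW andbT negb_and uv.
  + by move=> y z /EL-> /EL->; rewrite e_irr.
  + move=> w wW; have [uw|nuw] := boolP (e u w); last first.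
      have E : N w :&: links = set0.
        apply/setP => z; rewrite in_setI in_set0; apply/negP => /andP[+ /EL zu].
        by rewrite zu inE e_sym (negbTE nuw).
      by apply: enough_rest => // z; rewrite E inE.
    have [tw|ntw] := eqVneq (deg e w) #|W|.-1.
      have vw : v \in missing w.
        rewrite inE vW hv // andbT; apply: contraNneq uv => ->; exact: uw.
      apply: enough_rest => // [z|y z]; rewrite !in_setI.
        by case/andP=> _ /EL->; rewrite /c eqxx.
      by case/andP=> _ /EL-> /andP[_ /EL->].
    (* Now [w] has degree at least [#|W|], and its spare neighbor pays for the single link even if
       the color of that link is wasted. *)
    have h1 := subset_leq_card (subsetDl (missing w) (c @: (N w :&: links))).
    have h2 := missing_leq wW; have h3 := W_dense wW.
    have h4 : #|(N w :\: W) :&: links| <= 1.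
      rewrite -(cards1 u); apply: subset_leq_card; apply/subsetP => z.
      by rewrite in_setI in_set1 => /andP[_ /EL->].
    have := cardsD (N w :\: W) links; lia.
(* Colors from the lists [avail] that differ on conflicting links suffice: the room at each [w] then
   follows from [enough_rest]. *)
suff [c [c1 c2]] : exists c, list_coloring conf avail links c.
  exists (fun z => if z \in W then z else c z).
  have cW u : u \in links -> (u \in W) = false by move/links_notW/negbTE.
  split.
  + by move=> w ->.
  + move=> u uL; rewrite cW //; have := c1 u uL; rewrite !inE.
    by case/and3P=> -> /negbTE-> _.
  + move=> u v uL vL uv; rewrite !cW //; apply: c2 => //; rewrite /conf uv /= andbT.
    by apply: contraTneq uv => ->; rewrite e_irr.
  + move=> w wW; apply: enough_rest => // [u|u v]; rewrite !in_setI.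
      case/andP=> wu uL; rewrite cW //; have := c1 u uL; rewrite !inE in wu *.
      case/and3P=> -> uc /forall_inP h /=; rewrite h ?andbT; last first.
        by rewrite endsE e_sym wu.
      by apply: contraNneq uc => ->; rewrite e_sym.
    case/andP=> wu uL /andP[wv vL]; rewrite !cW // => E; apply/eqP/negPn/negP => uv.
    apply: (c2 u v) => //; rewrite /conf uv /=; apply/orP; right.
    rewrite !inE in wu wv.
    by apply/set0Pn; exists w; rewrite inE !endsE wW !(e_sym _ w) wu wv.
have [/exists_inP[u uL le]|] :=
    boolP [exists u in links, #|avail u| <= #|conflicts u|]; last first.
  rewrite negb_exists_in => /forall_inP h.
  have [||c [hc _]] := @list_coloring_greedy T T conf avail conf_sym conf_irr
     set0 links id.
  - by split=> [x|x y]; rewrite inE.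
  - move=> x xL; apply: leq_ltn_trans (_ : #|conflicts x| < _).
      apply: subset_leq_card; apply/subsetP => y; rewrite set0U !in_set.
      by case/and3P=> /andP[_ ->] ->.
    by rewrite ltnNge h.
  by exists c; rewrite set0U in hc.
(* The color b is forbidden at u anyway, so giving it to the conflicting v
   makes room for u, which is colored last. *)
have [v vc] : exists v, v \in conflicts u.
  by apply/card_gt0P; exact: leq_trans (av0 u uL) le.
move: (vc); rewrite inE => /andP[vL cuv].
have uv : u != v by case/andP: cuv.
have [b bu bv] : exists2 b, b \in ends u & b \notin ends v.
  by apply: links_end; rewrite // eq_sym.
have bA : b \in avail v.
  by apply: conf_avail bu bv; rewrite ?links_notW // conf_sym.
have [||c [hc cv]] := @list_coloring_greedy T T conf avail conf_sym conf_irr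
     [set v] (links :\ u :\ v) (fun=> b).
- split=> [x /set1P-> //|x y /set1P-> /set1P->]; by rewrite conf_irr.
(* Every other link [x] conflicts with [u], which is still uncolored; this makes the bound
   strict. *)
- move=> x; rewrite 2!in_setD1 => /and3P[xv xu xL].
  apply: leq_trans (conflicts_leq xL).
  have ux : u \in conflicts x by rewrite inE uL conf_sym (tight_conf uL le).
  rewrite (cardsD1 u (conflicts x)) ux add1n ltnS; apply: subset_leq_card.
  apply/subsetP => y; rewrite [in X in X -> _]inE => /and3P[+ cxy _].
  rewrite !in_setD1 in_setU in_set1 !in_setD1 in_conflicts cxy andbT.
  case/andP=> _ /orP[/eqP->|/and3P[_ -> ->] //].
  by rewrite vL eq_sym uv.
have SE : [set v] :|: links :\ u :\ v = links :\ u.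
  by rewrite setD1K // in_setD1 vL eq_sym uv.
rewrite SE in hc.
have [||c' [hc' _]] := @list_coloring_greedy T T conf avail conf_sym conf_irr
     (links :\ u) [set u] c.
- exact: hc.
- move=> x /set1P->; apply: leq_trans (conflicts_leq uL).
  rewrite (cardsD1 v (conflicts u)) vc add1n ltnS; apply: subset_leq_card.
  apply/subsetP => y; rewrite [in X in X -> _]inE => /and3P[+ cxy].
  rewrite !in_setD1 in_setU in_setD1 in_set1 => /andP[yu].
  rewrite (negbTE yu) /= orbF => yL; rewrite yL /= => cy.
  rewrite in_conflicts yL cxy !andbT; apply: contraTneq cy => ->.
  rewrite cv ?inE //; rewrite endsE in bu.
  by case/andP: bu => -> _; rewrite andbF.
by exists c'; move: hc'; rewrite setUC setD1K.
Qed.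


(** * The surroundings of a vertex of the good set, and crowded vertices *)

Definition private (w : T) : {set T} := N w :\: W :\: links.
(** The vertices that may obstruct the coloring of the private neighbors of [w]. An end is required
    because, outside [W], only vertices with an end are colored in this phase. *)
Definition second (w : T) : {set T} :=
  [set y | [&& y \notin W, ends y != set0 & [exists x in private w, e x y]]].
Definition around (w : T) : {set T} := (N w :&: links) :|: second w.

Lemma privateP w x : x \in private w -> [/\ e w x, x \notin W & x \notin links].
Proof. by rewrite 2!in_setD => /and3P[-> ->]; rewrite inE. Qed.

Lemma single_end x a b : x \notin W -> x \notin links ->
  a \in ends x -> b \in ends x -> a = b.
Proof.
move=> xW; rewrite inE xW -leqNgt => le ax bx.
by apply/eqP; apply: contraTT le => ab; rewrite -ltnNge; apply/card_gt1P; exists a, b.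
Qed.

Lemma private_end w x a : w \in W -> x \in private w -> a \in ends x -> a = w.
Proof.
move=> wW /privateP[wx xW xL] ax; apply: single_end xW xL ax _.
by rewrite endsE e_sym wx.
Qed.

Lemma secondP w y : w \in W -> y \in second w -> exists x,
  [/\ x \in private w, e x y & reach 2 w x y].
Proof.
move=> wW; rewrite inE => /and3P[yW _ /exists_inP[x xP xy]]; exists x; split=> //.
case/privateP: xP => wx _ _; apply: reachS (reach1 wx) xy _.
by rewrite eq_sym W_neq.
Qed.

Lemma second_end w y : w \in W -> y \in second w -> ~~ e y w.
Proof.
move=> wW yS; have [x [xP _ r2]] := secondP wW yS.
rewrite e_sym; apply/negP => wy; case/privateP: xP => _ + _.
by rewrite -(reach_uniq (reach1 wy) r2 isT) wW.
Qed.

Lemma second_notW w y : y \in second w -> y \notin W.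
Proof. by rewrite inE => /andP[]. Qed.

Lemma around_notW w z : z \in around w -> z \notin W.
Proof. by case/setUP => [/setIP[_]|]; [exact: links_notW | exact: second_notW]. Qed.

Lemma around_reach w z a : w \in W -> z \in around w -> a \in ends z -> a != w ->
  reach 3 w z a.
Proof.
move=> wW zA; rewrite endsE => /andP[za aW] aw.
case/setUP: zA => [/setIP[+ _]|zS].
  by rewrite inE => wz; apply: reachW (reachS (reach1 wz) za aw) _.
have [x [xP xz r2]] := secondP wW zS; apply: reachS r2 za _.
by case/privateP: xP => _ xW _; exact: W_neq.
Qed.

(** On [around w] this is an injection into the colors missing at [w], which yields [around_leq]. *)
Definition far_end w z := odflt z [pick a in ends z :\ w].

Lemma far_endP w z : w \in W -> z \in around w -> far_end w z \in ends z :\ w.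
Proof.
move=> wW zA; rewrite /far_end; case: pickP => //= h.
suff [a az aw] : exists2 a, a \in ends z & a != w by move: (h a); rewrite inE in_set1 aw az.
case/setUP: zA => [/setIP[_ zL]|zS]; first exact: link_other_end.
move: (zS); rewrite inE => /and3P[_ /set0Pn[a az] _]; exists a => //.
by apply: contraTneq az => ->; rewrite endsE (negbTE (second_end wW zS)).
Qed.

Lemma far_end_missing w : w \in W -> {in around w, forall z, far_end w z \in missing w}.
Proof.
move=> wW z zA; have /setD1P[aw az] := far_endP wW zA.
have r3 := around_reach wW zA az aw.
move: az; rewrite endsE inE => /andP[_ ->]; rewrite aw /=; apply/negP => wa.
by move: (around_notW zA); rewrite -(reach_uniq (reach1 wa) r3 isT) wW.
Qed.

Lemma far_end_inj w : w \in W -> {in around w &, injective (far_end w)}.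
Proof.
move=> wW z z' zA zA' E.
have /setD1P[aw az] := far_endP wW zA; have /setD1P[aw' az'] := far_endP wW zA'.
have r := around_reach wW zA az aw; have r' := around_reach wW zA' az' aw'.
by rewrite E in r; exact: (reach_uniq r r').
Qed.

Lemma around_card w : w \in W -> #|around w| = #|N w :&: links| + #|second w|.
Proof.
move=> wW; rewrite cardsU; suff -> : (N w :&: links) :&: second w = set0.
  by rewrite cards0 subn0.
apply/setP => z; rewrite in_setI in_setI in_set0; apply/negP => /andP[/andP[wz _]].
by move/(second_end wW); rewrite e_sym; rewrite inE in wz; rewrite wz.
Qed.

Lemma around_leq w : w \in W -> #|around w| <= #|missing w|.
Proof.
move=> wW; rewrite -(card_in_imset (far_end_inj wW)).
apply: subset_leq_card; apply/subsetP => _ /imsetP[z zA ->].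
exact: far_end_missing.
Qed.

(* Only a crowded w can lack room, once all its surroundings are colored. *)
Definition crowded w := (second w != set0) && (#|missing w| <= #|around w|).

Lemma crowded_far w : w \in W -> crowded w ->
  {in missing w, forall a, exists2 z, z \in around w & a = far_end w z}.
Proof.
move=> wW /andP[_ le].
exact: inj_card_surj (far_end_missing wW) (far_end_inj wW) le.
Qed.

(** Any end of [z] other than [w] is missing at [w], hence, as [far_end w] is onto, the far end of
    some vertex around [w]; uniqueness of short walks makes that vertex [z]. *)
Lemma crowded_end w z a b : w \in W -> crowded w -> z \in around w ->
  a \in ends z -> a != w -> b \in ends z -> b != w -> a = b.
Proof.
move=> wW cw zA az aw bz bw.
suff h d : d \in ends z -> d != w -> d = far_end w z by rewrite (h a) // (h b).
move=> dz dw; have r3 := around_reach wW zA dz dw.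
have dM : d \in missing w.
  move: (dz); rewrite endsE inE => /andP[_ ->]; rewrite dw /=; apply/negP => wd.
  by move: (around_notW zA); rewrite -(reach_uniq (reach1 wd) r3 isT) wW.
have [z' zA' E] := crowded_far wW cw dM.
have /setD1P[_ dz'] := far_endP wW zA'; rewrite -E in dz'.
by rewrite {1}E (reach_uniq r3 (around_reach wW zA' dz' dw)).
Qed.

Lemma crowded_cases w d : w \in W -> crowded w -> d \in W -> d != w ->
  e w d \/ exists2 z, z \in around w & e z d.
Proof.
move=> wW cw dW dw; have [wd|wd] := boolP (e w d); [by left | right].
have [|z zA E] := crowded_far wW cw (_ : d \in missing w).
  by rewrite inE dW dw.
by exists z => //; have := far_endP wW zA; rewrite -E in_setD1 endsE => /and3P[].
Qed.

Lemma crowded_reach w d : w \in W -> crowded w -> d \in W -> d != w ->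
  exists2 z, reach 3 w z d & z = w \/ z \in around w.
Proof.
move=> wW cw dW dw; have [wd|[z zA zd]] := crowded_cases wW cw dW dw.
  by exists w; [exact: reachW (reach1 wd) _ | left].
by exists z; [apply: around_reach; rewrite // endsE zd | right].
Qed.

(** A walk of length at most 5 joins [a], [y], [x], [r], [t], [d], where [t] may be [r]. If [a] or
    [d] were crowded, a walk of length at most 3 would join it to the other. As 3 + 5 = 8, both
    walks have the same last step, which makes [t] equal to [a] or a member of [around a], or [y]
    equal to [d] or a member of [around d]; each case is impossible. *)
Lemma crowded_alone r x y a t d : r \in W -> x \in private r -> e x y -> y \notin W ->
  a \in ends y -> a != r -> d \in W -> d != r -> e t d ->
  t = r \/ t \in N r :&: links -> ~~ crowded a /\ ~~ crowded d.
Proof.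
move=> rW xP xy yW; rewrite endsE => /andP[ya aW] ar dW dr td ht.
have [rx xW xL] := privateP xP.
have ra : r != a by rewrite eq_sym.
have rd : r != d by rewrite eq_sym.
have ay : e a y by rewrite e_sym.
have yx : e y x by rewrite e_sym.
have xr : e x r by rewrite e_sym.
have dt : e d t by rewrite e_sym.
have xa : x != a by rewrite eq_sym W_neq.
have yr : y != r by rewrite eq_sym W_neq.
have a3 : reach 3 a x r.
  by apply: reachS (reachS (reach1 ay) yx xa) xr _; rewrite eq_sym.
have tl : t != r -> [/\ e r t, t \in links, t != x & t \notin W].
  move=> tr; case: ht => [E|/setIP[+ tL]]; first by rewrite E eqxx in tr.
  rewrite inE => ->; split; rewrite ?links_notW //.
  by apply: contraNneq xL => <-.
have a4 : t != r -> reach 4 a r t.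
  by move=> /tl[rt _ tx _]; apply: reachS a3 rt tx.
have a5 : reach 5 a t d.
  have [E|tr] := eqVneq t r.
    rewrite E in td *; apply: reachW (reachS a3 td _) _ => //.
    by rewrite W_neq.
  exact: reachS (a4 tr) td dr.
have d3 : reach 3 d r x.
  have [E|tr] := eqVneq t r.
    rewrite E in dt; apply: reachW (reachS (reach1 dt) rx _) _ => //.
    by rewrite eq_sym W_neq.
  have [rt _ tx tW] := tl tr; have tr' : e t r by rewrite e_sym.
  by apply: reachS (reachS (reach1 dt) tr' rd) rx _; rewrite eq_sym.
have d4 : reach 4 d x y by apply: reachS d3 xy yr.
have d5 : reach 5 d y a by apply: reachS d4 ya _; rewrite W_neq.
have dW' z : z \notin W -> d != z by exact: W_neq.
have da : d != a.
  apply/eqP => E; rewrite -E in a3 a4.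
  have [Et|tr] := eqVneq t r.
    rewrite Et in dt; move: xW.
    by rewrite -(reach_uniq (reach1 dt) a3 isT) dW.
  by move/eqP: dr; apply; apply: (reach_uniq (reach1 dt) (a4 tr)).
split; apply/negP => cw.
  have [z r3 hz] := crowded_reach aW cw dW da.
  have zt : z = t := reach_uniq r3 a5 isT.
  subst z; have [E|tr] := eqVneq t r.
    rewrite E in hz; case: hz => [/eqP|/around_notW]; first by rewrite (negbTE ra).
    by rewrite rW.
  have [_ tL _ tW] := tl tr.
  case: hz => [E|/setUP[/setIP[+ _]|tS]]; first by rewrite E aW in tW.
    rewrite inE => at_; move/eqP: ar; apply.
    exact: (reach_uniq (reach1 at_) (a4 tr)).
  have [x' [/privateP[_ xW' _] _ r2]] := secondP aW tS.
  by rewrite (reach_uniq r2 (a4 tr) isT) rW in xW'.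
have ad : a != d by rewrite eq_sym.
have [z r3 hz] := crowded_reach dW cw aW ad.
have zy : z = y := reach_uniq r3 d5 isT.
subst z; case: hz => [E|/setUP[/setIP[+ _]|yS]]; first by rewrite E dW in yW.
  rewrite inE => dy; move: xW.
  by rewrite -(reach_uniq (reach1 dy) d4 isT) dW.
have [x' [xP' _ r2]] := secondP dW yS.
have E : x' = x := reach_uniq r2 d4 isT.
rewrite E in xP'; move/eqP: rd; apply; apply: private_end xP' _ => //.
by rewrite endsE xr.
Qed.

(** By [crowded_cases] every other [w] is adjacent to [r] or to a vertex around [r]. In
    [crowded_alone], [w] plays [d] if it is adjacent to [r] or to a link at [r], and [a] if it is
    adjacent to a vertex of [second r]. *)
Lemma crowded_only r : r \in W -> crowded r ->
  (exists t d, [/\ t = r \/ t \in N r :&: links, d \in W, d != r & e t d]) ->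
  {in W, forall w, w != r -> ~~ crowded w}.
Proof.
move=> rW cr [t [d [ht dW dr td]]] w wW wr.
have alone y a t' d' : y \in second r -> a \in ends y -> 
    t' = r \/ t' \in N r :&: links -> d' \in W -> d' != r -> e t' d' ->
    ~~ crowded a /\ ~~ crowded d'.
  move=> yS ay ht' dW' dr' td'; have [x [xP xy _]] := secondP rW yS.
  apply: (crowded_alone rW xP xy (second_notW yS) ay _ dW' dr' td' ht').
  by apply: contraTneq ay => ->; rewrite endsE (negbTE (second_end rW yS)).
have [y yS] : exists y, y \in second r by apply/set0Pn; case/andP: cr.
have [a ay] : exists a, a \in ends y by apply/set0Pn; move: yS; rewrite inE => /and3P[].
have [rw|[z /setUP[zL|zS] zw]] := crowded_cases rW cr wW wr.
- by case: (alone y a r w yS ay (or_introl erefl) wW wr rw).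
- by case: (alone y a z w yS ay (or_intror zL) wW wr zw).
- by have [] := alone z w t d zS; rewrite // endsE zw.
Qed.

(** Every other vertex of [W] is now joined to [r] by a walk of length 3 through [second r]. For a
    link with ends [p] and [q], going from [p] over the link to [q] and on to [r] has length 5;
    comparison with the walk of length 3 from [p] gives both walks the same vertex of [second r],
    which then has two ends besides [r], against [crowded_end]. *)
Lemma crowded_far_apart r : r \in W -> crowded r -> N r :&: W = set0 ->
  N r :&: links = set0 ->
  links = set0 /\ {in W, forall a, a != r -> exists x y,
    [/\ x \in private r, y \in private a, e x y & y \in second r]}.
Proof.
move=> rW cr NW NL.
have get a : a \in W -> a != r -> exists x y,
    [/\ x \in private r, e x y, e y a, reach 3 a x r & y \in second r].
  move=> aW ar; have [ra|[y]] := crowded_cases rW cr aW ar.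
    by move/setP/(_ a): NW; rewrite !inE ra aW.
  rewrite /around NL set0U => yS ya; have [x [xP xy _]] := secondP rW yS.
  exists x, y; split=> //; have [rx xW _] := privateP xP; have yW := second_notW yS.
  rewrite e_sym in xy; rewrite e_sym in ya; rewrite e_sym in rx.
  have h : x != a by rewrite eq_sym W_neq.
  by apply: reachS (reachS (reach1 ya) xy h) rx _; exact: W_neq.
have Lr u : u \in links -> ~~ e u r.
  move=> uL; rewrite e_sym; apply/negP => ru.
  by move/setP/(_ u): NL; rewrite in_setI uL !inE ru.
have L0 : links = set0.
  apply/setP => u; rewrite in_set0; apply/negP => uL.
  have uW := links_notW uL.
  have [p pu pr] := link_other_end r uL; have [q qu qp] := link_other_end p uL.
  have qr : q != r.
    by apply: contraTneq qu => ->; rewrite endsE (negbTE (Lr u uL)).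
  move: (pu) (qu); rewrite !endsE => /andP[up pW] /andP[uq qW].
  have [x [y [xP xy yp r3 yS]]] := get p pW pr.
  have [x' [y' [xP' xy' yq' r3' yS']]] := get q qW qr.
  have uS : u \notin second r.
    apply/negP => uS; have uA : u \in around r by rewrite inE uS orbT.
    by move/eqP: qp; apply; apply: (crowded_end rW cr uA).
  have pu' : e p u by rewrite e_sym.
  have qy' : e q y' by rewrite e_sym.
  have yx' : e y' x' by rewrite e_sym.
  have yW' := second_notW yS'.
  have [rx' xW' _] := privateP xP'.
  have xr' : e x' r by rewrite e_sym.
  have p4 : reach 4 p y' x'.
    apply: reachS (reachS (reachS (reach1 pu') uq qp) qy' _) yx' _.
      by apply: contraNneq uS => <-.
    by rewrite eq_sym W_neq.
  have p5 : reach 5 p x' r by apply: reachS p4 xr' _; rewrite W_neq.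
  have xx : x = x' := reach_uniq r3 p5 isT; subst x'.
  have py : e p y by rewrite e_sym.
  have yx : e y x by rewrite e_sym.
  have xp : x != p by rewrite eq_sym W_neq.
  have yy : y = y' := reach_uniq (reachS (reach1 py) yx xp) p4 isT; subst y'.
  have yA : y \in around r by rewrite inE yS orbT.
  move/eqP: qp; apply; apply: (crowded_end rW cr yA); rewrite // endsE.
    by rewrite yq' qW.
  by rewrite yp pW.
split=> // a aW ar; have [x [y [xP xy ya _ yS]]] := get a aW ar.
exists x, y; split=> //; rewrite /private L0 setD0 in_setD (second_notW yS) inE.
by rewrite e_sym.
Qed.


(** * Treating the vertices of the good set one by one, starting from a precoloring *)

Section Precolored.
Variables (K : {set T}) (c0 : T -> T).
Hypothesis Kends : {in K, forall u, ends u != set0}.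
Hypothesis LK : links \subset K.
Hypothesis c0W : {in W, forall w, c0 w = w}.
Hypothesis c0K : {in K, forall u, c0 u \in W}.
Hypothesis c0_proper : {in W :|: K &, forall u v, e u v -> c0 u <> c0 v}.
Hypothesis c0_room : {in W, forall w,
  #|missing w :\: c0 @: (N w :&: K)| <= #|N w :\: W :\: K|}.

Definition rest (w : T) : {set T} := N w :\: W :\: K.
Definition colored (Q : {set T}) : {set T} :=
  (W :|: K) :|: \bigcup_(w in Q) rest w.
(* A vertex of K colored w is no obstacle, as w is never given to a neighbor of
   w. *)
Definition obstacles (w : T) (Q : {set T}) : {set T} :=
  [set y in colored Q | [&& y \notin W, ~~ ((y \in K) && (c0 y == w)) &
                            [exists x in rest w, e x y]]].
(** This provides the strict inequality of [assign_avoiding]: the neighbors of [w] in [K] supply at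
    most [#|N w :&: K|] of the missing colors. *)
Definition clear (w : T) (Q : {set T}) : Prop :=
  obstacles w Q = set0 \/ #|N w :&: K| + #|obstacles w Q| < #|missing w|.
Definition extends (Q : {set T}) (c : T -> T) : Prop :=
  [/\ {in W :|: K, c =1 c0},
      {in colored Q, forall u, c u \in W},
      {in colored Q &, forall u v, e u v -> c u <> c v} &
      {in Q, forall w, {in missing w, forall v, exists2 x, e w x & c x = v}}].

Lemma restP w x : x \in rest w -> [/\ e w x, x \notin W & x \notin K].
Proof. by rewrite 2!in_setD => /and3P[-> ->]; rewrite inE. Qed.

Lemma rest_private w : rest w \subset private w.
Proof.
apply/subsetP => x; rewrite !in_setD => /andP[xK ->]; rewrite andbT.
by apply: contra xK; apply: subsetP.
Qed.

Lemma rest_end w v x : w \in W -> v \in W -> x \in rest w -> e v x -> v = w.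
Proof.
move=> wW vW /(subsetP (rest_private w)) xP vx; apply: private_end xP _ => //.
by rewrite endsE e_sym vx.
Qed.

Lemma coloredP (Q : {set T}) u : Q \subset W -> u \in colored Q -> u \notin W -> ends u != set0.
Proof.
move=> QW; rewrite !in_setU -orbA => /or3P[-> //|/Kends //|/bigcupP[w wQ /restP[wu _ _]] _].
by apply/set0Pn; exists w; rewrite endsE e_sym wu (subsetP QW).
Qed.

Lemma obstacles_second w (Q : {set T}) : w \in W -> Q \subset W -> obstacles w Q \subset second w.
Proof.
move=> wW QW; apply/subsetP => y; rewrite inE => /and4P[yc yW _ /exists_inP[x xR xy]].
rewrite inE yW (coloredP QW yc yW); apply/exists_inP; exists x => //.
exact: subsetP (rest_private w) _ _.
Qed.

Lemma obstacles_mono w (Q Q' : {set T}) : Q \subset Q' -> obstacles w Q \subset obstacles w Q'.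
Proof.
move=> QQ; apply/subsetP => y; rewrite !in_set => /andP[yc ->]; rewrite andbT.
case/orP: yc => [->//|/bigcupP[v vQ yv]]; apply/orP; right.
by apply/bigcupP; exists v => //; apply: subsetP vQ.
Qed.

Lemma clear_mono w (Q Q' : {set T}) : Q \subset Q' -> clear w Q' -> clear w Q.
Proof.
move=> QQ; have s := obstacles_mono w QQ; have := subset_leq_card s.
move=> le [E|lt]; last by right; lia.
by left; apply/eqP; move: s; rewrite E subset0.
Qed.

Lemma extends_step w (Q : {set T}) c : w \in W -> w \notin Q -> Q \subset W ->
  extends Q c -> clear w Q -> exists c', extends (w |: Q) c'.
Proof.
move=> wW wQ QW [cK cW cP cM] clr.
rewrite /clear in clr; set O := obstacles w Q in clr.
pose B := missing w :\: c0 @: (N w :&: K).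
pose forb x b := [|| b == w, b \notin W | [exists y in O, e x y && (c y == b)]].
pose b0 := odflt w [pick b in W :\: (w |: c @: O)].
have b0P x : x \in rest w -> ~~ forb x b0.
  move=> xR.
  have [b] : exists b, b \in W :\: (w |: c @: O).
    apply/set0Pn; rewrite -subset0 -setD_eq0 setD0 setD_eq0.
    apply/negP => /subset_leq_card; apply/negP; rewrite -ltnNge.
    case: clr => [E|lt].
      have [wx xW _] := restP xR; have [v vW [xv _]] := W_encircles xW.
      rewrite E imset0 setU0 cards1; apply/card_gt1P; exists v, w; split=> //.
      by apply: contraNneq xv => ->; rewrite e_sym.
    have h1 := cardsU1 w (c @: O); have h2 := leq_imset_card c O.
    have h3 := missing_card wW; have h4 := leq_b1 (w \notin c @: O); lia.
  rewrite /b0; case: pickP => [b' + _|/(_ b) -> //] => /=.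
  rewrite in_setD in_setU1 negb_or => /andP[/andP[bw bO] bW].
  rewrite /forb (negbTE bw) bW /=; apply/exists_inP => -[y yO /andP[_ /eqP E]].
  by case/imsetP: bO; exists y.
have rO y x x' : y \in O -> x \in rest w -> x' \in rest w -> e x y -> e x' y -> x = x'.
  rewrite inE => /and4P[_ yW _ _] /restP[wx _ _] /restP[wx' _ _] xy xy'.
  have yw : y != w by rewrite eq_sym W_neq.
  exact: (reach_uniq (reachS (reach1 wx) xy yw) (reachS (reach1 wx') xy' yw)).
have lt : B = set0 \/ #|[set p in setX (rest w) B | forb p.1 p.2]| < #|B|.
  have [B0|Bn0] := eqVneq B set0; [by left | right].
  have le : #|[set p in setX (rest w) B | forb p.1 p.2]| <= #|O|.
    pose g y := (odflt y [pick x in rest w | e x y], c y).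
    apply: leq_trans (leq_imset_card g _); apply: subset_leq_card.
    apply/subsetP => -[x b]; rewrite inE in_setX /= => /andP[/andP[xR bB]].
    move: bB; rewrite in_setD inE => /and4P[_ bW bw _].
    rewrite /forb (negbTE bw) bW /= => /exists_inP[y yO /andP[xy /eqP E]].
    apply/imsetP; exists y; rewrite // /g E; congr (_, _).
    case: pickP => [x' /andP[xR' xy']|/(_ x)]; last by rewrite xR xy.
    exact: (rO y).
  apply: leq_ltn_trans le _; case: clr => [->|clr].
    by rewrite cards0 card_gt0.
  have := cardsD (missing w) (c0 @: (N w :&: K)); rewrite -/B.
  have := leq_imset_card c0 (N w :&: K).
  have := subset_leq_card (subsetIr (missing w) (c0 @: (N w :&: K))); lia.
have [f [fR fB]] := assign_avoiding (c0_room wW) lt b0P.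
have fP x : x \in rest w -> [/\ f x != w, f x \in W &
    forall y, y \in O -> e x y -> f x <> c y].
  move=> xR; have [] := fR x xR; rewrite /forb !negb_or negbK.
  case/and3P=> -> -> /negP h _; split=> // y yO xy E; apply: h.
  by apply/exists_inP; exists y; rewrite // xy E eqxx.
have nR u : u \in colored Q -> (u \in rest w) = false.
  move=> uC; apply/negP => uR; have [wu uW uK] := restP uR.
  move: uC; rewrite !in_setU (negbTE uW) (negbTE uK) => /bigcupP[v vQ /restP[vu _ _]].
  by move: wQ; rewrite -(rest_end wW (subsetP QW v vQ) uR vu) vQ.
have WKC u : u \in W :|: K -> u \in colored Q by move=> h; rewrite /colored in_setU h.
have cross x y : x \in rest w -> y \in colored Q -> e x y -> f x <> c y.
  move=> xR yC xy; have [fw fW fO] := fP x xR.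
  have [yW|yW] := boolP (y \in W).
    rewrite cK ?inE ?yW // c0W // (rest_end wW yW xR) 1?e_sym //.
    exact/eqP.
  have [/andP[yK /eqP E]|nK] := boolP ((y \in K) && (c0 y == w)).
    by rewrite cK ?inE ?yK ?orbT // E; exact/eqP.
  apply: fO => //; rewrite inE yC yW nK; apply/exists_inP; by exists x.
have colU : colored (w |: Q) = colored Q :|: rest w.
  by rewrite /colored bigcup_setU big_set1 [rest w :|: _]setUC setUA.
exists (fun u => if u \in rest w then f u else c u); split.
- by move=> u uWK; rewrite nR ?cK // WKC.
- rewrite colU => u /setUP[uC|uR]; first by rewrite nR // cW.
  by rewrite uR; have [] := fP u uR.
- rewrite colU => u v /setUP[uC|uR] /setUP[vC|vR] uv.
  + by rewrite !nR //; exact: cP.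
  + by rewrite nR // vR => /esym; apply: cross; rewrite // e_sym.
  + by rewrite uR nR //; exact: cross.
  + have [wu uW _] := restP uR; have [wv vW _] := restP vR.
    have vw : v != w by rewrite eq_sym W_neq.
    move: uW; rewrite -(reach_uniq (reach1 wv) (reachS (reach1 wu) uv vw) isT).
    by rewrite wW.
- move=> v /setU1P[->|vQ] a aM.
    have [/imsetP[u /setIP[wu uK] E]|aK] := boolP (a \in c0 @: (N w :&: K)).
      exists u; first by move: wu; rewrite inE.
      by rewrite nR ?cK ?WKC // inE uK orbT.
    have [x xR E] := fB a (ltac:(by rewrite in_setD aK)).
    by exists x; rewrite ?xR //; have [] := restP xR.
  have [x vx E] := cM v vQ a aM; exists x; rewrite //.
  case: ifP => // xR.
  by move: wQ; rewrite -(rest_end wW (subsetP QW v vQ) xR vx) vQ.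
Qed.

(** Obstacles only grow with the treated set, so it is enough that each vertex is clear with all
    others of [A] treated; the order within [A] is then free. *)
Lemma extends_run (A Q : {set T}) c : A \subset W -> Q \subset W -> [disjoint A & Q] ->
  extends Q c -> {in A, forall w, clear w (Q :|: A :\ w)} ->
  exists c', extends (Q :|: A) c'.
Proof.
move=> AW QW + ext; move n: #|A| => k.
elim: k A n AW => [|k IH] A n AW AQ hA.
  by exists c; rewrite (cards0_eq n) setU0.
have [w wA] : exists w, w \in A by apply/card_gt0P; rewrite n.
have wW := subsetP AW w wA.
have sA : A :\ w \subset A by exact: subsetDl.
have [||||c' ext'] := IH (A :\ w).
- by move: (cardsD1 w A); rewrite n wA => -[].
- exact: subset_trans sA AW.
- exact: disjointWl sA AQ.
- move=> v /setD1P[_ vA]; apply: clear_mono (hA v vA).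
  by rewrite setUS // setSD.
have [|||||c'' ext''] := @extends_step w (Q :|: A :\ w) c'.
- exact: wW.
- by rewrite !inE eqxx orbF (disjointFr AQ wA).
- by rewrite subUset QW (subset_trans sA AW).
- exact: ext'.
- exact: hA.
by exists c''; move: ext''; rewrite setUCA setD1K.
Qed.

Lemma extends0 : extends set0 c0.
Proof.
have E : colored set0 = W :|: K by rewrite /colored big_set0 setU0.
split; rewrite ?E //.
- by move=> u /setUP[uW|/c0K //]; rewrite c0W.
- by move=> w; rewrite inE.
Qed.

Lemma not_crowded_clear w (Q : {set T}) : w \in W -> Q \subset W -> #|N w :&: K| = #|N w :&: links| ->
  ~~ crowded w -> clear w Q.
Proof.
move=> wW QW EK; have s := obstacles_second wW QW.
rewrite negb_and negbK -ltnNge (around_card wW) => /orP[/eqP E|lt].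
  by left; apply/eqP; move: s; rewrite E subset0.
by right; have := subset_leq_card s; lia.
Qed.

End Precolored.


(** * Supplying all missing colors, with a suitable order of treatment *)

Definition solution (S : {set T}) (c : T -> T) : Prop :=
  [/\ W \subset S, {in W, forall w, c w = w}, {in S, forall u, c u \in W},
      {in S &, forall u v, e u v -> c u <> c v} &
      {in W, forall w, {in missing w, forall v, exists2 x, e w x & c x = v}} /\
      forall w u, w \in W -> e w u -> u \in S].

Lemma solution_extends K c0 c : {in W, forall w, c0 w = w} ->
  extends K c0 W c -> solution (colored K W) c.
Proof.
move=> c0W [cK cW cP cM]; split=> //.
- by apply/subsetP => w wW; rewrite !in_setU wW.
- by move=> w wW; rewrite cK ?inE ?wW // c0W.
split=> // w u wW wu; rewrite !in_setU.
have [//|uW] := boolP (u \in W); have [//|uK] := boolP (u \in K).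
apply/bigcupP; exists w; rewrite // !in_setD uW uK inE.
exact: wu.
Qed.

Lemma proper_with_ends (K : {set T}) (c : T -> T) :
  {in W, forall w, c w = w} -> {in K, forall u, c u \in W :\: ends u} ->
  {in K &, forall u v, e u v -> c u <> c v} ->
  {in W :|: K &, forall u v, e u v -> c u <> c v}.
Proof.
move=> cW cK cP.
have WK w u : w \in W -> u \in K -> e u w -> w <> c u.
  move=> wW uK uw E; have := cK u uK.
  by rewrite -E in_setD endsE uw wW.
move=> u v /setUP[uW|uK] /setUP[vW|vK] uv; last exact: cP.
- by rewrite !cW // => E; rewrite E e_irr in uv.
- by rewrite (cW u uW); apply: WK; rewrite // e_sym.
- by rewrite (cW v vW) => /esym; exact: WK.
Qed.

Lemma links_ends : {in links, forall u, ends u != set0}.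
Proof. by move=> u uL; have [a au _] := link_other_end u uL; apply/set0Pn; exists a. Qed.

(* Precoloring y0, adjacent to e0 and at distance 2 from r, with r itself makes
   it harmless for r, which is then treated last; while r is untreated, its
   private neighbors leave room at every other vertex. *)
Lemma solution_apart r : r \in W -> crowded r -> N r :&: W = set0 ->
  N r :&: links = set0 -> exists S c, solution S c.
Proof.
move=> rW cr NW NL; have [L0 far] := crowded_far_apart rW cr NW NL.
have [y0 y0S] : exists y, y \in second r by apply/set0Pn; case/andP: cr.
have [e0 e0y] : exists a, a \in ends y0 by apply/set0Pn; move: y0S; rewrite inE => /and3P[].
have y0W := second_notW y0S.
have y0L : y0 \notin links by rewrite L0 inE.
have y0end w : w \in W -> e w y0 -> w = e0.
  by move=> wW wy; apply: (single_end y0W y0L); rewrite // endsE e_sym wy.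
move: (e0y); rewrite endsE => /andP[y0e0 e0W].
have e0r : e0 != r by apply: contraTneq y0e0 => ->; exact: second_end.
pose K := [set y0]; pose c0 z := if z == y0 then r else z.
have c0W : {in W, forall w, c0 w = w}.
  by move=> w wW; rewrite /c0 (negbTE (W_neq wW y0W)).
have c0K : {in K, forall u, c0 u \in W :\: ends u}.
  move=> u /set1P->; rewrite /c0 eqxx in_setD rW andbT endsE negb_and.
  by rewrite (second_end rW y0S).
have Kends : {in K, forall u, ends u != set0}.
  by move=> u /set1P->; apply/set0Pn; exists e0.
have LK : links \subset K by rewrite L0 sub0set.
have KW : [disjoint K & W] by rewrite disjoints1.
have NK w : w \in W -> w != e0 -> N w :&: K = set0.
  move=> wW we; apply/setP => z; rewrite in_setI in_set1 in_set0.
  apply/negP => /andP[wz /eqP E]; rewrite E inE in wz.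
  by rewrite (y0end w wW wz) eqxx in we.
have room : {in W, forall w, #|missing w :\: c0 @: (N w :&: K)| <= #|N w :\: W :\: K|}.
  move=> w wW; apply: enough_rest => // [u|u v]; rewrite !in_setI !in_set1.
    case/andP=> wu /eqP E; rewrite E inE in wu *.
    rewrite (y0end w wW wu) /c0 eqxx.
    apply: missing_sym => //; rewrite inE e0W e0r /=; apply/negP => h.
    by move/setP/(_ e0): NW; rewrite !inE h e0W.
  by case/andP=> _ /eqP-> /andP[_ /eqP->].
have ext0 : extends K c0 set0 c0.
  apply: extends0 => //.
    by move=> u /c0K /setDP[].
  apply: proper_with_ends => // u v /set1P-> /set1P->; by rewrite e_irr.
have seccard w : w \in W -> #|second w| <= #|missing w|.
  by move=> wW; apply: leq_trans (around_leq wW); rewrite around_card // leq_addl.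
(* Away from [e0], a single harmless member of [second w] is enough, since [second w] is no larger
   than [missing w]. *)
have fewer w (Q : {set T}) x : w \in W -> Q \subset W -> w != e0 -> x \in second w ->
    x \notin obstacles K c0 w Q -> clear K c0 w Q.
  move=> wW QW we xS xO; right; rewrite (NK w wW we) cards0 add0n.
  apply: leq_trans (seccard w wW); rewrite (cardsD1 x (second w)) xS add1n ltnS.
  apply: subset_leq_card; apply/subsetP => z zO.
  rewrite in_setD1 (subsetP (obstacles_second c0 Kends LK wW QW)) // andbT.
  by apply: contraNneq xO => <-.
have run := extends_run LK c0W room.
have [||||c1] := run [set e0] set0 c0 _ _ _ ext0; rewrite ?sub1set ?sub0set //.
- by rewrite disjoints1 inE.
(* Treated first, [e0] could only have [y0] as an obstacle, which would close a triangle. *)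
- move=> _ /set1P->; left; apply/setP => y; rewrite in_set0; apply/negP.
  rewrite set0U setDv inE /colored big_set0 setU0.
  case/andP=> /setUP[yW|/set1P->]; first by rewrite yW.
  case/and3P=> _ _ /exists_inP[x /restP[ex xW _] xy].
  have y0e : y0 != e0 by rewrite eq_sym W_neq.
  have ey0 : e e0 y0 by rewrite e_sym.
  by move: xW; rewrite -(reach_uniq (reach1 ey0) (reachS (reach1 ex) xy y0e) isT) e0W.
rewrite set0U => ext1.
have [||||c2] := run (W :\ r :\ e0) [set e0] c1 _ _ _ ext1; rewrite ?sub1set //.
- by apply: subset_trans (subsetDl _ _) (subsetDl _ _).
- by rewrite disjoint_sym disjoints1 !inE eqxx.
(* The harmless vertex is the private neighbor [x] of [r] on the walk to [w]: it is uncolored as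
   long as [r] is untreated. *)
- move=> w /setD1P[we /setD1P[wr wW]].
  have [x [y [xP yP xy yS]]] := far w wW wr.
  have [rx xW xL] := privateP xP.
  apply: (fewer _ _ x) => //.
  + by rewrite subUset sub1set e0W; apply: subset_trans (subsetDl _ _) _;
      apply: subset_trans (subsetDl _ _) (subsetDl _ _).
  + rewrite inE xW /=; apply/andP; split.
      by apply/set0Pn; exists r; rewrite endsE e_sym rx.
    by apply/exists_inP; exists y; rewrite // e_sym.
  rewrite inE negb_and; apply/orP; left.
  rewrite !in_setU (negbTE xW) in_set1 /= negb_or; apply/andP; split.
    by apply: contraTneq rx => ->; rewrite e_sym (second_end rW y0S).
  apply/bigcupP => -[v vQ /restP[vx _ _]].
  have vr : v != r.
    by move: vQ; rewrite !inE; case/orP => [/eqP->|/and4P[_ _ ->]].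
  have vW : v \in W.
    by move: vQ; rewrite !inE; case/orP => [/eqP->|/and4P[_ _ _ ->]].
  move/eqP: vr; apply; apply: (private_end rW xP).
  by rewrite endsE e_sym vx.
have E2 : [set e0] :|: W :\ r :\ e0 = W :\ r by rewrite setD1K // !inE e0r.
rewrite E2 => ext2.
have [||||c3] := run [set r] (W :\ r) c2 _ _ _ ext2; rewrite ?sub1set ?subsetDl //.
- by rewrite disjoints1 !inE eqxx.
- move=> _ /set1P->; apply: (fewer _ _ y0) => //.
  + by rewrite setDv setU0 subsetDl.
  + by rewrite eq_sym.
  rewrite inE; apply/negP => /and4P[_ _ /negP h _]; apply: h.
  by rewrite /c0 in_set1 !eqxx.
rewrite setUC setD1K // => ext3.
by exists (colored K W), c3; exact: (solution_extends c0W ext3).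
Qed.

Lemma solution_exists : exists S c, solution S c.
Proof.
have [c [cW cL cP cM]] := color_links.
have ext0 : extends links c set0 c.
  apply: extends0 => //; first by move=> u /cL /setDP[].
  exact: proper_with_ends.
have run := extends_run (subxx links) cW cM.
have ncc w (Q : {set T}) : w \in W -> Q \subset W -> ~~ crowded w -> clear links c w Q.
  by move=> wW QW; apply: (not_crowded_clear c links_ends).
have QW (Q A : {set T}) w : Q \subset W -> A \subset W -> Q :|: A :\ w \subset W.
  by move=> h h'; rewrite subUset h (subset_trans (subsetDl _ _) h').
have [/exists_inP[r rW cr]|] := boolP [exists r in W, crowded r]; last first.
  rewrite negb_exists_in => /forall_inP h.
  have [||||c' ext] := run W set0 c _ _ _ ext0; rewrite ?subxx ?sub0set //.
  - by rewrite disjoint_sym disjoints_subset sub0set.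
  - by move=> w wW; apply: ncc; rewrite ?QW ?sub0set // h.
  rewrite set0U in ext.
  by exists (colored links W), c'; exact: (solution_extends cW ext).
have [[NW NL]|h] : (N r :&: W = set0 /\ N r :&: links = set0) \/
    exists t d, [/\ t = r \/ t \in N r :&: links, d \in W, d != r & e t d].
  have [NW|[d]] := set_0Vmem (N r :&: W); last first.
    rewrite !inE => /andP[rd dW]; right; exists r, d; split=> //; first by left.
    by apply: contraTneq rd => ->; rewrite e_irr.
  have [NL|[t tL]] := set_0Vmem (N r :&: links); [by left | right].
  have [d + dr] := link_other_end r (proj2 (setIP tL)).
  by rewrite endsE => /andP[td dW]; exists t, d; split=> //; right.
  exact: solution_apart NL.
have only := crowded_only rW cr h.
have [||||c1] := run [set r] set0 c _ _ _ ext0; rewrite ?sub1set ?sub0set //.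
- by rewrite disjoints1 inE.
(* Treated first, [r] can only have links as obstacles, and a link in [second r] would have two ends
   other than [r], against [crowded_end]. *)
- move=> _ /set1P->; left; apply/setP => y; rewrite in_set0; apply/negP => yO.
  have yS : y \in second r.
    apply: subsetP yO; apply: (obstacles_second c links_ends) => //.
    by rewrite QW ?sub0set ?sub1set.
  move: yO; rewrite set0U setDv inE /colored big_set0 setU0 => /andP[+ _].
  case/setUP=> [yW|yL]; first by move: (second_notW yS); rewrite yW.
  have [a ay ar] := link_other_end r yL; have [b yb ba] := link_other_end a yL.
  have yA : y \in around r by rewrite inE yS orbT.
  move/eqP: ba; apply; apply: (crowded_end rW cr yA) => //.
  by apply: contraTneq yb => ->; rewrite endsE (negbTE (second_end rW yS)).
rewrite set0U => ext1.
have [||||c2 ext2] := run (W :\ r) [set r] c1 _ _ _ ext1; rewrite ?sub1set ?subsetDl //.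
- by rewrite disjoint_sym disjoints1 !inE eqxx.
- move=> w /setD1P[wr wW]; apply: ncc => //; last exact: only.
  by rewrite QW ?sub1set ?subsetDl.
rewrite setD1K // in ext2.
by exists (colored links W), c2; exact: (solution_extends cW ext2).
Qed.

End GoodSet.

(** * b-colorings *)

Section BColoring.
Variables (T : finType) (e : rel T).

(** One b-vertex from each class gives [k] distinct vertices of degree at least [k.-1]. *)
Lemma b_coloring_leq (k : nat) (c : {ffun T -> 'I_k}) :
  b_coloring e c -> k <= m_degree e.
Proof.
case/andP=> _ /forallP h.
have [v vP] : exists v : 'I_k -> T, forall i, (c (v i) == i) && b_vertex e c (v i).
  have h' i : {v | (c v == i) && b_vertex e c v} by apply/sigW/existsP; exact: h.
  by exists (fun i => sval (h' i)) => i; exact: svalP (h' i).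
have v_inj : injective v.
  by move=> i j E; case/andP: (vP i) (vP j) => /eqP<- _ /andP[/eqP<- _]; rewrite E.
have kT : k <= #|T| by rewrite -[k]card_ord; exact: leq_card v_inj.
have kdeg i : k.-1 <= deg e (v i).
  have /andP[/eqP ci /forallP bi] := vP i.
  have -> : k.-1 = #|[set~ i]| by rewrite cardsC1 card_ord.
  apply: leq_trans (leq_imset_card c (nbh e (v i))); apply: subset_leq_card.
  apply/subsetP => j; rewrite !inE => ji.
  have := bi j; rewrite ci ji => /exists_inP[u uN /eqP <-]; exact: imset_f.
apply: (@bigmax_sup _ (Ordinal (ltnSE kT : k < #|T|.+1))) => //=.
have E : #|v @: 'I_k| = k by rewrite card_imset // card_ord.
rewrite -{1}E; apply: subset_leq_card.
by apply/subsetP => _ /imsetP[i _ ->]; rewrite inE.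
Qed.

(** Each [w] in [W] is a b-vertex of its own color: a color [v] appears at the neighbor [v] itself
    or is missing at [w] and supplied. Colors are numbered by their position in [enum W]. *)
Lemma b_coloring_of (W : {set T}) (c : T -> T) :
  {in W, forall w, c w = w} -> (forall u, c u \in W) ->
  (forall u v, e u v -> c u <> c v) ->
  {in W, forall w, {in missing e W w, forall v, exists2 x, e w x & c x = v}} ->
  exists b : {ffun T -> 'I_#|W|}, b_coloring e b.
Proof.
move=> cW cT cP cM.
have lt u : index (c u) (enum W) < #|W| by rewrite cardE index_mem mem_enum.
pose b := [ffun u => Ordinal (lt u)].
have bE u v : (b u == b v) = (c u == c v).
  rewrite !ffunE -val_eqE /=; apply/eqP/eqP => [|-> //].
  by move=> E; apply: (index_inj (c u)) E; rewrite mem_enum.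
have col (i : 'I_#|W|) : exists2 w, w \in W & b w = i.
  have iW : i < size (enum W) by rewrite -cardE.
  have x0 : T by case: (enum W) iW => [//|x _] _.
  have wW : nth x0 (enum W) i \in W by rewrite -mem_enum mem_nth.
  exists (nth x0 (enum W) i) => //; apply: val_inj.
  by rewrite ffunE /= cW // index_uniq ?enum_uniq.
exists b; apply/andP; split.
  by apply/forallP => u; apply/forallP => v; apply/implyP => /cP /eqP; rewrite bE.
apply/forallP => i; have [w wW <-] := col i; apply/existsP; exists w.
rewrite eqxx; apply/forallP => j; have [v vW <-] := col j.
rewrite bE !cW //; apply/implyP => vw; apply/exists_inP.
have [wv|wv] := boolP (e w v); first by exists v; rewrite ?inE.
have [|x wx E] := cM w wW v; first by rewrite inE vW vw.
by exists x; rewrite ?inE // bE E cW.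
Qed.

End BColoring.

Theorem theorem5 (T : finType) (e : rel T)
    (e_sym : symmetric e) (e_irr : irreflexive e)
    (e_girth : girth_geq e 9)
    (e_good : exists W : {set T}, good_set e W) :
  b_chromatic e = m_degree e.
Proof.
have [W /and4P[/subsetP Wd /eqP Wm /forall_inP Wenc /forall_inP Whigh]] := e_good.
apply/eqP; rewrite eqn_leq; apply/andP; split.
  by apply/bigmax_leqP => k /existsP[c]; exact: b_coloring_leq.
have W_dense : {in W, forall w, #|W|.-1 <= deg e w}.
  by move=> w /Wd; rewrite inE Wm.
have W_encircles u : u \notin W -> exists2 v, v \in W &
    ~~ e u v /\ forall w, w \in W -> e u w -> deg e w = #|W|.-1 -> ~~ e w v.
  move=> uW; have := Wenc u; rewrite inE uW => /(_ isT).
  rewrite negb_forall_in => /exists_inP[v vW]; rewrite negb_or => /andP[vu /exists_inP h].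
  exists v => //; split=> [|w wW uw wm]; first by rewrite e_sym.
  apply/negP => wv; apply: h; exists w => //.
  by rewrite e_sym wv uw wm Wm /=.
have [S [c [WS cW cS cP [cM SN]]]] :=
  solution_exists e_sym e_irr e_girth W_dense W_encircles.
have [||c' [[c'W c'P] c'S]] :=
    @list_coloring_greedy T T e (fun=> W) e_sym e_irr S (~: S) c.
- by split.
(* All neighbors of [W] lie in [S], so an uncolored [x] has none in [W], and condition (b) of a good
   set bounds its degree below [#|W|]. *)
- move=> x; rewrite inE => xS.
  have xW : x \notin W by apply: contra xS; exact: (subsetP WS).
  have lt : deg e x < #|W|.
    rewrite Wm ltnNge; apply/negP => high.
    have := Whigh x; rewrite inE xW => /(_ isT)/implyP/(_ high)/exists_inP[w wW xw].
    by move/negP: xS; apply; apply: (SN w); rewrite // e_sym.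
  apply: leq_ltn_trans lt; apply: subset_leq_card; apply/subsetP => y.
  by rewrite in_set => /and3P[_ xy _]; rewrite inE.
rewrite setUCr in c'W c'P.
have [||||b hb] := @b_coloring_of T e W c'.
- by move=> w wW; rewrite c'S ?cW // (subsetP WS).
- by move=> u; apply: c'W; rewrite inE.
- by move=> u v; apply: c'P; rewrite inE.
- move=> w wW v vM; have [x wx E] := cM w wW v vM.
  by exists x; rewrite // c'S // (SN w).
rewrite -Wm; apply: (@bigmax_sup _ (Ordinal (max_card W : #|W| < #|T|.+1))) => //=.
by apply/existsP; exists b.
Qed.
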